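(* Let $n\ge 1$ and $w \in S_n$. Then $$\#\mathcal{P}_w = \sum_{\substack{v \in S_n,\ v \geq w \\ v \text{ avoids } 123}} g(v),$$ where $\geq$ is the strong Bruhat order on $S_n$.
   Context: For integers $a \le b$, $[a,b] = \{a, a+1, \ldots, b\}$ and $[n]=[1,n]$. For $w \in S_n$, let $M_w$ be a generic $n \times 2n$ matrix whose nonzero entries in row $i$ are exactly in columns $[w(i), i+n]$ (generic: the nonzero entries are algebraically independent). $\mathcal{P}_w$ is the set of $n$-subsets $I$ of $[2n]$ such that the $n \times n$ minor of $M_w$ in rows $[n]$ and columns $I$ is nonzero. Equivalently, $\mathcal{P}_w$ is the set of transversals of the set collection $([w(i), i+n])_{1 \le i \le n}$, i.e. the sets $\{x_1,\ldots,x_n\}$ with the $x_i$ distinct and $x_i \in [w(i), i+n]$. An anti-fixed point of $v \in S_n$ is $i \in [n]$ with $v(i) = n-i+1$. If $\ell_1, \ldots, \ell_k$ are the lengths of the maximal runs of consecutive anti-fixed points of $v$ (i.e. the sizes of the maximal intervals contained in the set of anti-fixed points), then $g(v) = C_{\ell_1+1} \cdots C_{\ell_k+1}$, where $C_j = \frac{1}{j+1}\binom{2j}{j}$ is the $j$th Catalan number (an empty product is $1$). A permutation avoids $123$ if it has no (not necessarily consecutive) increasing subsequence of length $3$. *)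

(* Defs.v *)
From HB Require Import structures.
From mathcomp Require Import all_boot all_order all_fingroup all_algebra.
From mathcomp Require Import mpoly.

Set Implicit Arguments.
Unset Strict Implicit.
Unset Printing Implicit Defensive.

Import GRing.Theory.
Local Open Scope ring_scope.

(* Rows, columns and the values of permutations are numbered from 0, so row i,
   column j here stand for row i + 1, column j + 1 of the usual convention. *)

Definition alg_indep (k K : fieldType) (iota : {rmorphism k -> K}) (m : nat)
    (x : 'I_m -> K) : Prop :=
  forall p : {mpoly k[m]}, p != 0 -> (map_mpoly iota p).@[x] != 0.

Definition nz_entries (K : fieldType) (m n : nat) (M : 'M[K]_(m, n)) :
    {set 'I_m * 'I_n} :=
  [set ij | M ij.1 ij.2 != 0].

(* With 1-based indices the support of row i is [w(i), i + n]; shifting i, j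
   and w(i) by one leaves the shape of the inequalities unchanged. *)
Definition generic_mx (n : nat) (k K : fieldType) (iota : {rmorphism k -> K})
    (w : 'S_n) (M : 'M[K]_(n, n + n)) : Prop :=
  (forall i j, (M i j != 0) = (w i <= j <= i + n)%N) /\
  alg_indep iota (fun e : 'I_#|nz_entries M| =>
                    M (enum_val e).1 (enum_val e).2).

(* [enum I] is increasing; the default value of [nth] is never used when
   #|I| = n. *)
Definition col_minor (n : nat) (K : fieldType) (M : 'M[K]_(n, n + n))
    (I : {set 'I_(n + n)}) : K :=
  \det (\matrix_(i < n, j < n) M i (nth (lshift n j) (enum I) j)).

Definition bases (n : nat) (K : fieldType) (M : 'M[K]_(n, n + n)) :
    {set {set 'I_(n + n)}} :=
  [set I : {set 'I_(n + n)} | (#|I| == n) && (col_minor M I != 0)].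

Definition perm_length (n : nat) (v : 'S_n) : nat :=
  #|[set ij : 'I_n * 'I_n | (ij.1 < ij.2)%N && (v ij.2 < v ij.1)%N]|.

Definition bruhat_step (n : nat) : rel 'S_n := fun u v =>
  [exists i : 'I_n, exists j : 'I_n, v == (tperm i j * u)%g] &&
  (perm_length u < perm_length v)%N.

(* Reflexive transitive closure.  Multiplying by transpositions on the other
   side gives the same order, as v^-1 t v is again a transposition. *)
Definition bruhat_le (n : nat) : rel 'S_n := connect (@bruhat_step n).

Definition avoids123 (n : nat) (v : 'S_n) : bool :=
  ~~ [exists i : 'I_n, exists j : 'I_n, exists k : 'I_n,
        [&& (i < j)%N, (j < k)%N, (v i < v j)%N & (v j < v k)%N]].

Definition antifixed (n : nat) (v : 'S_n) : {set 'I_n} :=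
  [set i | v i == rev_ord i].

Definition is_interval (n : nat) (A : {set 'I_n}) : bool :=
  [exists a : 'I_n, exists b : 'I_n,
     (a <= b)%N && (A == [set i : 'I_n | (a <= i <= b)%N])].

Definition antifixed_run (n : nat) (v : 'S_n) (A : {set 'I_n}) : bool :=
  maxset (fun B => is_interval B && (B \subset antifixed v)) A.

Definition catalan (j : nat) : nat := ('C(2 * j, j) %/ j.+1)%N.

Definition g (n : nat) (v : 'S_n) : nat :=
  (\prod_(A : {set 'I_n} | antifixed_run v A) catalan #|A|.+1)%N.

(* The hypothesis [generic_mx] is satisfiable over every base field. *)
Lemma generic_mx_exists (n : nat) (k : fieldType) (w : 'S_n) :
  exists (K : fieldType) (iota : {rmorphism k -> K}) (M : 'M[K]_(n, n + n)),
    generic_mx iota w M.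
Proof.
pose A := [set ij : 'I_n * 'I_(n + n) | (w ij.1 <= ij.2 <= ij.1 + n)%N].
pose Q : idomainType := {mpoly k[#|A|]}.
pose iota : {rmorphism k -> {fraction Q}} := @tofrac Q \o @mpolyC #|A| k.
pose M : 'M[{fraction Q}]_(n, n + n) :=
  \matrix_(i, j) \sum_(e < #|A| | enum_val e == (i, j)) @tofrac Q 'X_e.
exists {fraction Q}, iota, M.
have ME (e : 'I_#|A|) : M (enum_val e).1 (enum_val e).2 = @tofrac Q 'X_e.
  rewrite mxE -surjective_pairing (big_pred1 e) // => f /=.
  exact: (inj_eq enum_val_inj).
have suppM i j : (M i j != 0) = (w i <= j <= i + n)%N.
  have [ijA|ijA] := boolP (w i <= j <= i + n)%N.
    have inA : (i, j) \in A by rewrite inE.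
    have := ME (enum_rank_in inA (i, j)); rewrite enum_rankK_in //= => ->.
    by rewrite tofrac_eq0 -msupp_eq0 msuppX.
  rewrite mxE big_pred0 ?eqxx // => e; apply/negP => /eqP eij.
  by have := enum_valP e; rewrite eij inE /= (negPf ijA).
split=> //.
have : nz_entries M = A by apply/setP => -[i j]; rewrite !inE suppM.
move: (nz_entries M) => B -> p p0.
suff -> : (map_mpoly iota p).@[fun e => M (enum_val e).1 (enum_val e).2]
          = @tofrac Q p by rewrite tofrac_eq0.
rewrite (meval_eq _ ME) [in LHS](mpolyE p) [in RHS](mpolyE p) (rmorph_sum (@tofrac Q)).
rewrite (raddf_sum (map_mpoly iota)) raddf_sum /=.
apply: eq_bigr => m _; rewrite map_mpolyZ map_mpolyX mevalZ mevalX.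
rewrite -mul_mpolyC rmorphM /=; congr (_ * _).
by rewrite mpolyXE_id rmorph_prod; apply: eq_bigr => e _; rewrite rmorphXn.
Qed.

(* Main.v *)
Require Import Defs.
From HB Require Import structures.
From mathcomp Require Import all_boot all_order all_fingroup all_algebra.
From mathcomp Require Import mpoly zify.

(* Write r_v(p, q) for the number of i < p with v(i) < q; Bruhat order is the
   reversed pointwise order on these rank functions.  A set I of n columns is
   encoded by A = I cap [n] and by the complement D of {b : n + b in I} in [n],
   two sets of the same size a.  By Hall's theorem I is a basis for w iff
     r_w(p, q) >= f(p, q) := max(0, p + q - n, |D cap [p]| + |A cap [q]| - a)
   for all p, q.  The function f is itself r_v for a unique permutation v, and v
   avoids 123; so I is a basis for w iff w <= v.  It remains to count the I with
   a given v.  On the antidiagonal put m(p) = r_v(p, n - p) - s(p), where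
   s(p) = |D cap [p]| + |A cap [n - p]| - a: then f = r_v says that D and A
   are forced at the steps which are not antifixed points of v, that m = 0 at
   both ends of such steps, and that m >= 0.  On a run of l antifixed points
   m is thus a Motzkin path with two kinds of level steps, and there are
   C_(l+1) of these. *)

Set Implicit Arguments.
Unset Strict Implicit.
Unset Printing Implicit Defensive.

Import GRing.Theory.

(** * Rank functions and Bruhat order *)

Section Rank.
Variable n : nat.
Implicit Types u v w : 'S_n.

Definition rk v p q : nat := \sum_(i < n) ((i < p) && (v i < q)).

Lemma rk0l v q : rk v 0 q = 0.
Proof. by rewrite /rk big1. Qed.

Lemma rk0r v p : rk v p 0 = 0.
Proof. by rewrite /rk big1 // => i _; rewrite andbF. Qed.

Lemma rkV v p q : rk v^-1 p q = rk v q p.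
Proof.
rewrite /rk (reindex_inj (@perm_inj _ v)); apply: eq_bigr => i _ /=.
by rewrite permK andbC.
Qed.

Lemma rkSl v (p : 'I_n) q : rk v p.+1 q = rk v p q + (v p < q).
Proof.
rewrite /rk (bigD1 p) //= [in RHS](bigD1 p) //= ltnn ltnSn add0n addnC.
congr (_ + _); apply: eq_bigr => i; rewrite -val_eqE /= => ip.
by rewrite ltnS leq_eqVlt (negPf ip).
Qed.

Lemma rkSr v p (q : 'I_n) : rk v p q.+1 = rk v p q + ((v^-1)%g q < p).
Proof. by rewrite -!(rkV v) rkSl. Qed.

Lemma rk_stepl v p p' q : p <= p' <= n ->
  rk v p q <= rk v p' q <= rk v p q + (p' - p).
Proof.
elim: p' => [|k IH] /andP[pk kn]; first by rewrite (_ : p = 0) ?leqnn ?leq_addr; lia.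
have [->|pk'] := eqVneq p k.+1; first by lia.
by have := rkSl v (Ordinal kn) q => /= ->; case: (_ < q) IH; lia.
Qed.

Lemma rk_stepr v p q q' : q <= q' <= n ->
  rk v p q <= rk v p q' <= rk v p q + (q' - q).
Proof. by rewrite -!(rkV v); apply: rk_stepl. Qed.

Lemma rknl v q : q <= n -> rk v n q = q.
Proof.
elim: q => [|q IH] qn; first by rewrite rk0r.
by have := rkSr v n (Ordinal qn) => /= ->; rewrite ltn_ord IH; lia.
Qed.

(** The first [q] columns hold [q] dots, at most [n - p] of them in rows from [p] on. *)
Lemma rk_ge v p q : p <= n -> q <= n -> p + q <= n + rk v p q.
Proof.
move=> pn qn; have := @rk_stepl v p n q; rewrite pn leqnn rknl //.
by move=> /(_ isT); lia.
Qed.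

Lemma rk_mono v p q p' q' : p <= p' -> q <= q' -> rk v p q <= rk v p' q'.
Proof. by move=> pp qq; apply: leq_sum => i _; lia. Qed.

Lemma rk_min v p q : rk v p q = rk v (minn p n) (minn q n).
Proof.
apply: eq_bigr => i _; have := ltn_ord i; have := ltn_ord (v i).
by move=> ? ?; congr nat_of_bool; lia.
Qed.

Lemma rk_inj u v : (forall p q, p <= n -> q <= n -> rk u p q = rk v p q) -> u = v.
Proof.
move=> E; apply/permP => i; apply/val_inj/eqP; rewrite eqn_leq.
have ij := ltn_ord i; have ui := ltn_ord (u i); have vi := ltn_ord (v i).
have := E i.+1 (u i).+1 ij ui; have := E i (u i).+1 (ltnW ij) ui.
have := E i.+1 (v i).+1 ij vi; have := E i (v i).+1 (ltnW ij) vi.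
rewrite !rkSl /= !ltnS !leqnn; lia.
Qed.

Lemma rk_swap u (i j : 'I_n) p q : i < j -> u i < u j ->
  rk u p q = rk (tperm i j * u) p q + [&& i < p, p <= j, u i < q & q <= u j].
Proof.
move=> ij uij; have jNi : j != i by rewrite -val_eqE /=; lia.
rewrite /rk (bigD1 i) //= (bigD1 j) //= [in RHS](bigD1 i) //=.
rewrite [X in _ = _ + X + _](bigD1 j) //= !permM tpermL tpermR.
set S := \sum_(k < n | _) _; set S' := \sum_(k < n | _) _.
have -> : S = S'.
  apply: eq_bigr => k /andP[ki kj]; rewrite permM tpermD // eq_sym //.
lia.
Qed.

(* The number of non-inversions, which a rank inequality bounds more directly
   than the length. *)
Definition coinv v : nat := \sum_(i < n) rk v i (v i).

(** Every pair of positions is an inversion or not, so the length rises exactly when [coinv]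
    falls. *)
Lemma perm_length_coinv v :
  perm_length v + coinv v = \sum_(i < n) \sum_(j < n) (j < i : nat).
Proof.
have -> : perm_length v = \sum_(i < n) \sum_(j < n) ((j < i) && (v i < v j)).
  rewrite /perm_length -sum1_card exchange_big pair_big /= [RHS]big_mkcond /=.
  rewrite big_mkcond /=; apply: eq_bigr => -[i j] _; rewrite inE /=.
  by case: (_ && _).
rewrite -big_split; apply: eq_bigr => i _ /=; rewrite /rk -big_split.
apply: eq_bigr => j _ /=; have [ji|] := boolP (j < i) => //=.
have : v i != v j by rewrite (inj_eq perm_inj) -val_eqE /=; lia.
by rewrite -val_eqE /=; lia.
Qed.

Lemma coinv_swap u (i j : 'I_n) : i < j -> u i < u j ->
  coinv (tperm i j * u) < coinv u.
Proof.
move=> ij uij; have jNi : j != i by rewrite -val_eqE /=; lia.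
have sw := rk_swap _ _ ij uij.
rewrite /coinv (bigD1 i) //= (bigD1 j) //= [ltnRHS](bigD1 i) //=.
rewrite [X in _ < _ + X](bigD1 j) //= !permM tpermL tpermR.
set S := \sum_(k < n | _) _; set S' := \sum_(k < n | _) _.
have SS : S <= S'.
  apply: leq_sum => k /andP[ki kj]; rewrite permM tpermD 1?eq_sym //.
  by have := sw k (u k); lia.
have h1 := sw i (u j); have h2 := sw j (u i).
(* The right side minus the left counts the dots of [u] in rows [[i, j)] and columns [[u i, u j)];
   the dot of row [i] is one. *)
suff : rk u i (u j) + rk u j (u i) < rk u i (u i) + rk u j (u j) by lia.
rewrite /rk -!big_split /= (bigD1 i) //= [ltnRHS](bigD1 i) //= ltnn ij uij /=.
rewrite ltnn add0n ltnS; apply: leq_sum => k _; lia.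
Qed.

(** Were the two values in decreasing order, [coinv_swap] applied to the swapped permutation would
    show that the length drops. *)
Lemma bruhat_step_swap u v : bruhat_step u v ->
  exists i j : 'I_n, [/\ i < j, u i < u j & v = (tperm i j * u)%g].
Proof.
case/andP => /existsP[i /existsP[j /eqP ->]] len.
have [ij|ji|/val_inj ij] := ltngtP i j; last first.
- by move: len; rewrite ij tperm1 mul1g ltnn.
- exists j, i; rewrite tpermC; split => //.
  rewrite ltnNge; apply/negP => uij.
  have uji : u i < u j.
    rewrite ltn_neqAle uij andbT val_eqE (inj_eq perm_inj) -val_eqE /=; lia.
  have h : (tperm j i * u)%g j < (tperm j i * u)%g i.
    by rewrite !permM tpermL tpermR.
  have := coinv_swap ji h; rewrite mulgA tperm2 mul1g.
  rewrite (tpermC i j) in len.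
  have := perm_length_coinv u; have := perm_length_coinv (tperm j i * u).
  lia.
exists i, j; split => //.
rewrite ltnNge; apply/negP => uij.
have uji : u j < u i.
  rewrite ltn_neqAle uij andbT val_eqE (inj_eq perm_inj) -val_eqE /=; lia.
have h : (tperm i j * u)%g i < (tperm i j * u)%g j.
  by rewrite !permM tpermL tpermR.
have := coinv_swap ij h; rewrite mulgA tperm2 mul1g.
have := perm_length_coinv u; have := perm_length_coinv (tperm i j * u).
lia.
Qed.

Lemma swap_bruhat_step u (i j : 'I_n) : i < j -> u i < u j ->
  bruhat_step u (tperm i j * u)%g.
Proof.
move=> ij uij; apply/andP; split.
  by apply/existsP; exists i; apply/existsP; exists j.
have := perm_length_coinv u; have := perm_length_coinv (tperm i j * u).
have := coinv_swap ij uij; lia.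
Qed.

(* Take the first i with w i <> v i, then the first j > i with w j in
   (w i, v i]. *)
Lemma rk_swap_ge w v : (forall p q, rk v p q <= rk w p q) -> w != v ->
  exists i j : 'I_n, [/\ i < j, w i < w j &
    forall p q, rk v p q <= rk (tperm i j * w) p q].
Proof.
move=> le_vw wv.
have [i0 wvi0] : exists i, w i != v i.
  apply/existsP; apply: contraR wv; rewrite negb_exists => /forallP E.
  by apply/eqP/permP => i; apply/eqP; rewrite -[_ == _]negbK E.
case: (@arg_minnP _ i0 (fun i => w i != v i) val wvi0) => i wvi imin.
have eqi (k : 'I_n) : k < i -> w k = v k.
  by move=> ki; apply/eqP; apply: contraLR ki => /imin /=; lia.
have eqrk p q : p <= i -> rk w p q = rk v p q.
  move=> pi; apply: eq_bigr => k _; have [kp|//] := boolP (k < p).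
  by rewrite eqi //; lia.
have lti : w i < v i.
  have := le_vw i.+1 (v i).+1; rewrite !rkSl eqrk // ltnSn.
  by move: wvi; rewrite -val_eqE /=; lia.
pose P (j : 'I_n) := (i < j) && (w i < w j <= v i).
have Pj0 : P ((w^-1)%g (v i)).
  rewrite /P permKV lti leqnn !andbT ltn_neqAle.
  apply/andP; split; first by apply: contraNneq wvi => /val_inj e; rewrite {1}e permKV.
  rewrite leqNgt; apply/negP => /[dup] /eqi; rewrite permKV => /perm_inj <-.
  by rewrite ltnn.
case: (@arg_minnP _ _ P val Pj0) => j /andP[ij /andP[wij wjv]] jmin.
exists i, j; split => // p q.
have := rk_swap p q ij wij.
have [/and4P[ip pj wiq qwj]|_] := boolP [&& _, _, _ & _]; last first.
  by rewrite addn0 => <-.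
(* In the first [p] rows and columns [q] to [v i], [v] has more dots than [w]: rows before [i]
   agree, row [i] counts for [v] only, and later rows have no dot of [w] there by minimality of
   [j]. *)
suff : rk w p (v i).+1 + rk v p q + 1 <= rk w p q + rk v p (v i).+1.
  by have := le_vw p (v i).+1; lia.
have -> : 1 = \sum_(k < n) (k == i : nat).
  by rewrite (bigD1 i) //= eqxx big1 // => k /negPf ->.
rewrite /rk -!big_split /=; apply: leq_sum => k _.
have [ki|ik|/val_inj ->] := ltngtP k i.
- rewrite eqi //; have -> : (k == i) = false by rewrite -val_eqE /=; lia.
  by rewrite addn0 addnC.
- have -> : (k == i) = false by rewrite -val_eqE /=; lia.
  have [kp|//] := ltnP k p.
  have : ~~ P k by apply/negP => /jmin /=; lia.
  rewrite /P; lia.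
- rewrite eqxx; lia.
Qed.

(** A step can only lower ranks, by [rk_swap]. Conversely [rk_swap_ge] supplies steps that stay
    above [rk v], and [coinv] decreases until [v] is reached. *)
Lemma bruhat_le_rk w v :
  bruhat_le w v <-> (forall p q, rk v p q <= rk w p q).
Proof.
split=> [/connectP[s]|].
  elim: s w => [|u s IH] w /=; first by move=> _ -> p q.
  case/andP => /bruhat_step_swap[i [j [ij wij ->]]] ps vE p q.
  by apply: leq_trans (IH _ ps vE p q) _; rewrite (rk_swap p q ij wij) leq_addr.
have [k] := ubnP (coinv w); elim: k w => // k IH w wk le_vw.
have [->|wv] := eqVneq w v; first exact: connect0.
have [i [j [ij wij le_vw']]] := rk_swap_ge le_vw wv.
apply: connect_trans (connect1 (swap_bruhat_step ij wij)) _.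
by apply: IH le_vw'; have := coinv_swap ij wij; lia.
Qed.

End Rank.

(** * Transversals *)

(* Rado's proof: shrink the sets one element at a time.  If neither of two
   elements x, y of A t can be deleted, the violated inequalities for X and Y
   contradict submodularity. *)
Lemma hall_marriage (T S : finType) (A : T -> {set S}) :
  (forall X : {set T}, #|X| <= #|\bigcup_(t in X) A t|) ->
  exists2 f : T -> S, injective f & forall t, f t \in A t.
Proof.
have [m] := ubnP (\sum_t #|A t|); elim: m A => // m IH A szA hallA.
have A_gt0 t : 0 < #|A t| by have := hallA [set t]; rewrite big_set1 cards1.
have [/existsP[t t_gt1]|] := boolP [exists t, 1 < #|A t|]; last first.
  (* All sets are now singletons, and the hypothesis on pairs makes them distinct. *)
  rewrite negb_exists => /forallP A_le1.
  have [f fA] : exists f : T -> S, forall t, f t \in A t.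
    exists (fun t => xchoose (card_gt0P (A_gt0 t))) => t.
    exact: (xchooseP (card_gt0P (A_gt0 t))).
  have A1 t x : x \in A t -> x = f t.
    move=> xA; have /card_le1P h : #|A t| <= 1 by have := A_le1 t; lia.
    by have := h _ (fA t) x; rewrite xA inE => /esym/eqP.
  exists f => // t u ftu; apply/eqP; apply: contraT => tu.
  have := hallA [set t; u]; rewrite cards2 tu ltnNge => /negP[].
  apply: leq_trans (eq_leq (cards1 (f t))); apply: subset_leq_card.
  apply/subsetP => x /bigcupP[v]; rewrite !inE => /orP[]/eqP -> /A1 -> //.
  by rewrite ftu.
have /card_gt1P[x [y [xA yA xy]]] := t_gt1.
pose U (X : {set T}) := \bigcup_(u in X) A u.
pose B z u := if u == t then A t :\ z else A u.
have trim z : z \in A t ->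
    (exists2 f : T -> S, injective f & forall u, f u \in A u) \/
    exists2 X : {set T}, t \in X & #|A t :\ z :|: U (X :\ t)| < #|X|.
  move=> zA; have UB (X : {set T}) : \bigcup_(u in X) B z u =
      if t \in X then A t :\ z :|: U (X :\ t) else U X.
    case: ifP => tX.
      rewrite (big_setD1 t tX) /= {1}/B eqxx; congr (_ :|: _).
      by apply: eq_bigr => u; rewrite !inE /B => /andP[/negPf ->].
    by apply: eq_bigr => u uX; rewrite /B; case: eqP => // ut; rewrite -ut uX in tX.
  have [/forallP hB|] := boolP [forall X : {set T}, #|X| <= #|\bigcup_(u in X) B z u|].
    left; have [|//|f finj fB] := IH (B z).
      rewrite -ltnS; apply: leq_trans szA; rewrite !ltnS.
      rewrite (bigD1 t) //= [ltnRHS](bigD1 t) //= {1}/B eqxx.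
      rewrite [in ltnRHS](cardsD1 z) zA add1n addSn ltnS leq_add2l.
      by apply: leq_sum => u; rewrite /B => /negPf ->.
    exists f => // u; have := fB u; rewrite /B; case: eqP => // ->.
    by rewrite inE => /andP[].
  rewrite negb_forall => /existsP[X]; rewrite -ltnNge UB; right; exists X.
    by apply: contraLR p => /negPf ->; rewrite -leqNgt hallA.
  by move: p; case: ifP => // _; rewrite ltnNge hallA.
have [//|[X tX ltX]] := trim x xA; have [//|[Y tY ltY]] := trim y yA.
set P := _ :|: _ in ltX; set Q := _ :|: _ in ltY.
have hU : #|U (X :|: Y)| <= #|P :|: Q|.
  apply/subset_leq_card/subsetP => z /bigcupP[u uXY zu].
  rewrite !inE; have [ut|ut] := eqVneq u t.
    by rewrite -ut zu !andbT; case: eqVneq => //= ->; rewrite xy !orbT.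
  case/setUP: uXY => uX.
    have -> : z \in U (X :\ t) by apply/bigcupP; exists u; rewrite // !inE ut.
    by rewrite !orbT.
  have -> : z \in U (Y :\ t) by apply/bigcupP; exists u; rewrite // !inE ut.
  by rewrite !orbT.
have hI : #|U ((X :&: Y) :\ t)| <= #|P :&: Q|.
  apply/subset_leq_card/subsetP => z /bigcupP[u]; rewrite !inE => /and3P[ut uX uY] zu.
  have -> : z \in U (X :\ t) by apply/bigcupP; exists u; rewrite // !inE ut.
  have -> : z \in U (Y :\ t) by apply/bigcupP; exists u; rewrite // !inE ut.
  by rewrite !orbT.
(* The choice of [X] and [Y] gives [#|P| + #|Q| <= #|X| + #|Y| - 2], whereas Hall's condition for
   these two sets gives at least [#|X| + #|Y| - 1]. *)
have := hallA (X :|: Y); have := hallA ((X :&: Y) :\ t); rewrite -!/(U _).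
have := cardsUI P Q; have := cardsUI X Y; have := cardsD1 t (X :&: Y).
by rewrite inE tX tY; lia.
Qed.

Section Transversals.
Variable n : nat.
Implicit Types (w : 'S_n) (I : {set 'I_(n + n)}).

Definition transversal w I : Prop :=
  exists2 f : 'I_n -> 'I_(n + n), injective f &
    forall i, f i \in I /\ w i <= f i <= i + n.

(** * Nonzero minors of a generic matrix *)

Section Minor.
Variables (k K : fieldType) (iota : {rmorphism k -> K}).
Variables (w : 'S_n) (M : 'M[K]_(n, n + n)) (hM : generic_mx iota w M).
Variables (I : {set 'I_(n + n)}) (cI : #|I| = n).
Local Open Scope ring_scope.

Let c (j : 'I_n) : 'I_(n + n) := nth (lshift n j) (enum I) j.

Let szI (j : 'I_n) : (j < size (enum I))%N.
Proof. by rewrite -cardE cI. Qed.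

Let c_in j : c j \in I.
Proof. by rewrite -mem_enum mem_nth. Qed.

Let c_inj : injective c.
Proof.
move=> i j; rewrite /c (set_nth_default (lshift n j) _ (szI i)) => /eqP.
by rewrite nth_uniq ?enum_uniq // => /eqP/val_inj.
Qed.

(** A nonzero determinant has a nonzero Leibniz term. *)
Lemma transversal_minor : col_minor M I != 0 -> transversal w I.
Proof.
move=> det0; have [s sP] : exists s : 'S_n, \prod_i M i (c (s i)) != 0.
  apply/existsP; apply: contraNT det0; rewrite negb_exists => /forallP E.
  rewrite /col_minor /determinant big1 // => s _.
  rewrite (eq_bigr (fun i => M i (c (s i)))); last by move=> i _; rewrite !mxE.
  by have := E s; rewrite negbK => /eqP ->; rewrite mulr0.
exists (fun i => c (s i)) => [i j /c_inj/perm_inj //|i]; split; first exact: c_in.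
rewrite -hM.1; apply: contraNneq sP => Mi.
by rewrite (bigD1 i) //= Mi mul0r.
Qed.

(* The determinant is a polynomial in the nonzero entries; it takes the value
   +-1 at the incidence vector of a transversal. *)
Lemma minor_transversal : transversal w I -> col_minor M I != 0.
Proof.
case=> f f_inj fP; set A := nz_entries M.
have inA i : (i, f i) \in A by rewrite inE /= hM.1; case: (fP i).
pose X : 'M[{mpoly k[#|A|]}]_n :=
  \matrix_(i, j) \sum_(e < #|A| | enum_val e == (i, c j)) 'X_e.
have sumA (F : fieldType) (h : 'I_n * 'I_(n + n) -> F) ij :
    \sum_(e < #|A| | enum_val e == ij) h (enum_val e) =
    if ij \in A then h ij else 0.
  case: ifP => [ijA|ijA].
    rewrite (big_pred1 (enum_rank_in ijA ij)) ?enum_rankK_in // => e /=.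
    by rewrite -(inj_eq enum_val_inj) enum_rankK_in.
  by rewrite big_pred0 // => e; apply: contraFF ijA => /eqP <-; apply: enum_valP.
have detX : \det X != 0.
  pose y (e : 'I_#|A|) : k := (f (enum_val e).1 == (enum_val e).2)%:R.
  have s_lt i : (index (f i) (enum I) < n)%N.
    by rewrite -[X in (_ < X)%N]cI cardE index_mem mem_enum; case: (fP i).
  have cs i : c (Ordinal (s_lt i)) = f i.
    by rewrite /c nth_index // mem_enum; case: (fP i).
  have s_inj : injective (fun i => Ordinal (s_lt i)).
    by move=> i j ij; apply: f_inj; rewrite -!cs ij.
  have : (\det X).@[y] != 0.
    suff -> : (\det X).@[y] = \det (perm_mx (perm s_inj) : 'M[k]_n).
      by rewrite det_perm signr_eq0.
    rewrite -(det_map_mx (meval y)); congr (\det _); apply/matrixP => i j.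
    rewrite !mxE raddf_sum permE -(inj_eq c_inj) cs /=.
    rewrite (eq_bigr y) => [|e _]; last exact: mevalXU.
    rewrite (sumA k (fun ij => (f ij.1 == ij.2)%:R)) /=.
    by case: ifP => //; case: eqP => // <-; rewrite inA.
  by apply: contraNneq => ->; rewrite meval0.
have := hM.2 _ detX; rewrite -(det_map_mx (map_mpoly iota)).
set x := (fun e => _); rewrite -(det_map_mx (meval x)) /col_minor.
congr (\det _ != 0); apply/matrixP => i j; rewrite !mxE (raddf_sum (map_mpoly iota)) raddf_sum /=.
rewrite (eq_bigr x) => [|e _]; last by rewrite map_mpolyX mevalXU.
rewrite (sumA K (fun ij => M ij.1 ij.2)) /= inE /=.
by case: ifP => // /negbFE/eqP.
Qed.

End Minor.

(* alpha I p = |D cap [p]| and beta I q = |A cap [q]|; frk is the function f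
   of the header, the truncated subtractions accounting for the 0. *)
Definition alpha I p : nat := \sum_(i < n) ((i < p) && (rshift n i \notin I)).
Definition beta I q : nat := \sum_(j < n) ((j < q) && (lshift n j \in I)).
Definition frk I p q : nat := maxn (alpha I p + beta I q - beta I n) (p + q - n).

Lemma sum_ltn p : p <= n -> \sum_(i < n) (i < p : nat) = p.
Proof.
move=> pn; transitivity (\sum_(i < n | i < p) 1).
  by rewrite [RHS]big_mkcond; apply: eq_bigr => i _; case: (i < p).
by rewrite -(big_ord_widen n (fun=> 1) pn) sum1_card card_ord.
Qed.

(** The window meets [I] in [beta I n - beta I q] columns of the left half and [p - alpha I p] of
    the right half. *)
Lemma card_window I p q : p <= n -> q <= n ->
  #|[set x in I | q <= x < n + p]| + alpha I p + beta I q = beta I n + p.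
Proof.
have ifE (b : bool) : (if b then 1 else 0) = b by case: b.
move=> pn qn; rewrite -[X in _ = _ + X](sum_ltn pn) /alpha /beta -sum1_card big_mkcond /=.
rewrite big_split_ord /= -addnA [X in _ + X = _]addnC addnACA.
congr (_ + _); rewrite -big_split; apply: eq_bigr => i _; rewrite ifE inE /=.
  by have := ltn_ord i; case: (_ \in I) => /=; lia.
by case: (_ \in I) => /=; lia.
Qed.

Lemma card_rows w p q : p <= n ->
  #|[set i : 'I_n | (i < p) && (q <= w i)]| + rk w p q = p.
Proof.
move=> pn; rewrite -[RHS](sum_ltn pn) -sum1_card big_mkcond /rk -big_split /=.
by apply: eq_bigr => i _; rewrite inE; case: ifP; lia.
Qed.

(** Every interval [[w i, i + n]] contains [n - 1] and [n], so a union of them is again an interval,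
    from the least [w i] to the largest [i + n]. Hall's condition therefore need only be tested on
    windows [[q, n + p)]. *)
Lemma transversal_rk w I :
  transversal w I <->
  (forall p q, p <= n -> q <= n -> frk I p q <= rk w p q).
Proof.
(* The term [p + q - n] of [frk] is bounded by every rank function. *)
have suffF p q : p <= n -> q <= n ->
    (frk I p q <= rk w p q) = (alpha I p + beta I q <= beta I n + rk w p q).
  by move=> pn qn; have := rk_ge w pn qn; rewrite /frk; lia.
split=> [[f f_inj fP] p q pn qn|H].
  rewrite suffF //; have := card_window I pn qn; have := card_rows w q pn.
  set X := (X in #|X| + rk _ _ _); set W := (X in #|X| + alpha _ _ + _).
  suff : #|X| <= #|W| by lia.
  rewrite -(card_imset _ f_inj); apply/subset_leq_card/subsetP => x.
  by case/imsetP => i; rewrite !inE => iX ->; have [-> /=] := fP i; lia.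
have [X|f f_inj fA] := @hall_marriage _ _ (fun i : 'I_n => [set x in I | w i <= x <= i + n]).
  have [->|[i0 i0X]] := set_0Vmem X; first by rewrite cards0.
  case: (@arg_maxnP _ i0 (mem X) val i0X) => i /= iX imax.
  case: (@arg_minnP _ i0 (mem X) (fun i => w i) i0X) => j /= jX jmin.
  have iln := ltn_ord i; have wln := ltnW (ltn_ord (w j)).
  have := H i.+1 (w j) iln wln; rewrite suffF //.
  have := card_window I iln wln; have := card_rows w (w j) iln.
  set Y := (X in #|X| + rk _ _ _); set W := (X in #|X| + alpha _ _ + _).
  set U := \bigcup_(_ in _) _.
  have XY : #|X| <= #|Y|.
    apply/subset_leq_card/subsetP => l lX; rewrite inE jmin // andbT ltnS.
    exact: imax.
  have WU : #|W| <= #|U|.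
    apply/subset_leq_card/subsetP => x; rewrite inE => /and3P[xI wx xi].
    apply/bigcupP; have [xn|nx] := ltnP x n.
      by exists j; rewrite // inE xI; lia.
    by exists i; rewrite // inE xI; have := ltn_ord (w i); lia.
  move=> rows win H1; apply: leq_trans XY (leq_trans _ WU); lia.
by exists f => // i; have := fA i; rewrite inE => /andP[].
Qed.

End Transversals.

(** * The permutation attached to a set of columns *)

Section Fibre.
Variable n : nat.
Implicit Types (v w : 'S_n) (I : {set 'I_(n + n)}).

Lemma alpha0 I : alpha I 0 = 0.
Proof. by rewrite /alpha big1. Qed.

Lemma beta0 I : beta I 0 = 0.
Proof. by rewrite /beta big1. Qed.

Lemma alphaS I (p : 'I_n) : alpha I p.+1 = alpha I p + (rshift n p \notin I).
Proof.
rewrite /alpha (bigD1 p) //= [in RHS](bigD1 p) //= ltnn ltnSn add0n addnC.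
congr (_ + _); apply: eq_bigr => i; rewrite -val_eqE /= => ip.
by rewrite ltnS leq_eqVlt (negPf ip).
Qed.

Lemma betaS I (p : 'I_n) : beta I p.+1 = beta I p + (lshift n p \in I).
Proof.
rewrite /beta (bigD1 p) //= [in RHS](bigD1 p) //= ltnn ltnSn add0n addnC.
congr (_ + _); apply: eq_bigr => i; rewrite -val_eqE /= => ip.
by rewrite ltnS leq_eqVlt (negPf ip).
Qed.

Lemma alpha_le I p : p <= n -> alpha I p <= p.
Proof.
by move=> pn; rewrite -[leqRHS](sum_ltn pn); apply: leq_sum => i _; lia.
Qed.

Lemma alpha_mono I p p' : p <= p' -> alpha I p <= alpha I p'.
Proof. by move=> pp; apply: leq_sum => i _; lia. Qed.

Lemma beta_mono I q q' : q <= q' -> beta I q <= beta I q'.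
Proof. by move=> qq; apply: leq_sum => i _; lia. Qed.

Lemma card_alpha_beta I : #|I| + alpha I n = beta I n + n.
Proof.
have := card_window I (leqnn n) (leq0n n); rewrite beta0 addn0 => <-.
by congr (_ + _); apply: eq_card => x; rewrite inE ltn_ord !andbT.
Qed.

Lemma frk_rowS I (p : 'I_n) q : frk I p q <= frk I p.+1 q <= frk I p q + 1.
Proof. by rewrite /frk alphaS; lia. Qed.

Lemma frk_colS I p (q : 'I_n) : frk I p q <= frk I p q.+1 <= frk I p q + 1.
Proof. by rewrite /frk betaS; lia. Qed.

(** Together with [frk_rowS] and [frk_colS]: the increments along a row or a column step are 0 or 1
    and never return from 1 to 0. *)
Lemma frk_supermod I (p q : 'I_n) :
  frk I p.+1 q + frk I p q.+1 <= frk I p q + frk I p.+1 q.+1.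
Proof. by rewrite /frk alphaS betaS; case: (_ \in I); case: (_ \in I); lia. Qed.

(** The increment of row [p] is 0 at [q = 0] and 1 at [q = n], where [frk I p n = p]; [x] is the
    place of its only jump. *)
Lemma frk_jump I (cI : #|I| = n) (p : 'I_n) :
  exists x : 'I_n, forall q, q <= n -> frk I p.+1 q = frk I p q + (x < q).
Proof.
have pn := ltn_ord p; have ab := card_alpha_beta I.
pose P (x : 'I_n) := frk I p x.+1 < frk I p.+1 x.+1.
have last_lt : n.-1 < n by lia.
have Plast : P (Ordinal last_lt).
  rewrite /P /= prednK ?(leq_ltn_trans _ pn) // /frk.
  by have := alpha_le I pn; have := alpha_le I (ltnW pn); lia.
case: (@arg_minnP _ _ P val Plast) => x Px xmin.
have up k : x < k <= n -> frk I p k < frk I p.+1 k.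
  elim: k => // k IH /andP[xk kn].
  have [->//|xk'] := eqVneq k x; have := frk_supermod I p (Ordinal kn) => /=.
  by have := IH _; lia.
exists x => q qn; have := frk_rowS I p q.
have [xq|qx] := ltnP x q; first by have := up q; lia.
case: q => [|q] in qn qx *.
  have := beta0 I; rewrite /frk.
  by have := alpha_mono I pn; have := alpha_mono I (ltnW pn); lia.
have := xmin (Ordinal qn); rewrite /P /=.
by case: (ltnP (frk I p q.+1)) => h1 h2; [have := h2 isT|]; lia.
Qed.

Lemma frk_perm I (cI : #|I| = n) :
  exists v : 'S_n, forall p q, p <= n -> q <= n -> rk v p q = frk I p q.
Proof.
have /fin_all_exists[f fP] := frk_jump cI.
(* If two rows jumped at the same [x], the increment of [frk] across column [x] would reach 2 after
   the second. *)
have f_lt (i j : 'I_n) : i < j -> f i != f j.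
  move=> ij; apply/eqP => fij; set x := f i in fij *.
  have xn := ltn_ord x.
  have up k : i < k <= n -> frk I k x < frk I k x.+1.
    elim: k => // k IH /andP[ik kn].
    have [ki|ki] := eqVneq k i.
      rewrite ki !(fP i) ?(ltnW xn) // -/x ltnn ltnSn.
      by have := frk_colS I i x; lia.
    by have := frk_supermod I (Ordinal kn) x; have := IH _; rewrite /=; lia.
  have jn := ltn_ord j; have := up j; have := frk_colS I j.+1 x.
  by rewrite !(fP j) ?(ltnW xn) // -fij ltnn ltnSn; lia.
have f_inj : injective f.
  move=> i j fij; have [/f_lt|/f_lt|/val_inj //] := ltngtP i j.
    by rewrite fij eqxx.
  by rewrite fij eqxx.
exists (perm f_inj); elim=> [|p IH] q pn qn.
  by rewrite rk0l /frk alpha0; have := beta_mono I qn; lia.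
have := rkSl (perm f_inj) (Ordinal pn) q; have := fP (Ordinal pn) q qn.
by rewrite permE /= => -> ->; rewrite IH // ltnW.
Qed.

Lemma rk_NW v p q : 0 < rk v p q -> exists2 i : 'I_n, i < p & v i < q.
Proof.
rewrite lt0n sum_nat_eq0 negb_forall => /existsP[i]; rewrite eqb0 negbK.
by case/andP => *; exists i.
Qed.

Lemma rk_SE v p q : p <= n -> q <= n ->
  p + q + \sum_(i < n) ((p <= i) && (q <= v i)) = n + rk v p q.
Proof.
move=> pn qn; rewrite -{1}(sum_ltn pn) -{1}(rknl v qn) -[X in _ = X + _](sum_ltn (leqnn n)).
rewrite /rk -!big_split; apply: eq_bigr => i _ /=.
by have := ltn_ord i; lia.
Qed.

(* A dot of v has no dot to its north-west or no dot to its south-east. *)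
Lemma avoids_rk v : reflect
  (forall p : 'I_n, rk v p (v p) = 0 \/ p + v p + 1 = n + rk v p (v p))
  (avoids123 v).
Proof.
apply: (iffP idP) => [av p|H].
  have [->|r_gt0] := posnP (rk v p (v p)); [by left|right].
  have pn := ltn_ord p; have vpn := ltn_ord (v p).
  have rkSS : rk v p.+1 (v p).+1 = rk v p (v p) + 1.
    by rewrite rkSl rkSr permK ltnn ltnSn addn0.
  have := rk_ge v pn vpn; rewrite rkSS leq_eqVlt => /predU1P[|lt_p]; first lia.
  have [i ip vip] := rk_NW r_gt0.
  have := rk_SE v pn vpn; rewrite rkSS => SE.
  have : 0 < \sum_(i < n) ((p < i) && (v p < v i)) by lia.
  rewrite lt0n sum_nat_eq0 negb_forall => /existsP[k]; rewrite eqb0 negbK.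
  case/andP=> pk vpk; case/existsP: av; exists i; apply/existsP; exists p; apply/existsP; exists k.
  by rewrite ip pk vip vpk.
apply/existsP => -[i /existsP[j /existsP[k /and4P[ij jk vij vjk]]]].
have : 0 < rk v j (v j).
  by rewrite /rk (bigD1 i) //= ij vij.
have := rk_SE v (ltn_ord j) (ltn_ord (v j)); rewrite (bigD1 k) //= jk vjk.
rewrite rkSl rkSr permK ltnn ltnSn; case: (H j); lia.
Qed.

(** At a dot the mixed difference of [frk] is 1, but that of [alpha + beta] is 0. So a truncation
    acts at some corner: 0 gives the first alternative of [avoids_rk], [p + q - n] the second. *)
Lemma frk_avoids v I : (forall p q, p <= n -> q <= n -> rk v p q = frk I p q) ->
  avoids123 v.
Proof.
move=> E; apply/avoids_rk => p.
have pn := ltn_ord p; have vpn := ltn_ord (v p).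
have := E p (v p) (ltnW pn) (ltnW vpn); have := E p.+1 (v p) pn (ltnW vpn).
have := E p (v p).+1 (ltnW pn) vpn; have := E p.+1 (v p).+1 pn vpn.
rewrite !rkSl !rkSr permK !ltnn !ltnSn /frk alphaS betaS.
by case: (_ \in I); case: (_ \in I); lia.
Qed.

(** * Reduction to the antidiagonal *)

Section Diagonal.
Variable v : 'S_n.

(* The steps of alpha, beta and rk v along the antidiagonal p + q = n. *)
Definition rho p := rk v p (n - p).
Definition colD (p : 'I_n) : bool := (v^-1)%g (rev_ord p) < p.

Lemma rhoS (p : 'I_n) : rho p.+1 + colD p = rho p + (v p < n - p.+1).
Proof.
rewrite /rho rkSl /colD; have := rkSr v p (rev_ord p); rewrite /= subnSK // => ->.
exact: addnAC.
Qed.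

Lemma alpha_betaS I (p : 'I_n) :
  alpha I p.+1 + beta I (n - p.+1) + (lshift n (rev_ord p) \in I) =
  alpha I p + beta I (n - p) + (rshift n p \notin I).
Proof.
rewrite alphaS; have := betaS I (rev_ord p); rewrite /= subnSK // => ->.
by rewrite -!addnA; congr (_ + _); rewrite addnC -addnA.
Qed.

(** A dot above the antidiagonal is counted by [rho p.+1]; for one below it, [rk_ge] at
    [(p.+1, n - p)] makes [rho p] positive. *)
Lemma rho_nonantifixed (p : 'I_n) : v p != rev_ord p -> 0 < rho p + rho p.+1.
Proof.
rewrite -val_eqE /= => vp; have pn := ltn_ord p.
have := rk_ge v pn (leq_subr p n); rewrite rkSl -/(rho p).
by rewrite /rho rkSl; case: (ltngtP (v p) (n - p.+1)) vp; lia.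
Qed.

(** On the antidiagonal the term [p + q - n] vanishes. The subtraction is truncated: where
    [rho p = 0] the first clause is only an upper bound on [alpha + beta]. *)
Definition fibre_cond I : Prop :=
  (forall p, p <= n -> alpha I p + beta I (n - p) - beta I n = rho p) /\
  (forall p : 'I_n, v p != rev_ord p -> (rshift n p \notin I) = (p + v p < n)).

Lemma frk_fibre_cond I :
  (forall p q, p <= n -> q <= n -> rk v p q = frk I p q) -> fibre_cond I.
Proof.
move=> E; split=> [p pn|p].
  by rewrite /rho E ?leq_subr // /frk subnKC // subnn maxn0.
rewrite -val_eqE /= => vp; have pn := ltn_ord p.
(* Column [n - p.+1] serves for a dot above the antidiagonal: the rank rises there, so [alpha] must.
   Column [n - p] serves for one below: the rank stays positive and constant, so [alpha] cannot
   rise. *)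
have [pvp|pvp] := ltnP (p + v p) n.
  have qn : n - p.+1 <= n by lia.
  have := E p _ (ltnW pn) qn; have := E p.+1 _ pn qn.
  rewrite rkSl /frk alphaS; case: (_ \in I) => //=; lia.
have qn : n - p <= n by lia.
have := E p _ (ltnW pn) qn; have := E p.+1 _ pn qn.
rewrite rkSl /frk alphaS; case: (_ \in I) => //=; lia.
Qed.

Hypothesis av : avoids123 v.

(** On the antidiagonal both alternatives of [avoids_rk] say that the rank at the dot is 0. *)
Lemma rho_antifixed (p : 'I_n) : v p = rev_ord p -> rho p = 0 /\ rho p.+1 = 0.
Proof.
move=> vp; have := rhoS p; rewrite /colD -vp permK ltnn vp /= ltnn !addn0.
move=> ->; suff : rho p = 0 by [].
have := rkSr v p (rev_ord p); rewrite -vp permK ltnn vp /= subnSK // => e.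
rewrite /rho e; have /avoids_rk/(_ p) := av; rewrite vp /=.
by have := ltn_ord p; lia.
Qed.

(* Induction on the distance to the antidiagonal p + q = n, on either side. *)
Lemma fibre_cond_frk I : #|I| = n -> fibre_cond I ->
  forall p q, p <= n -> q <= n -> rk v p q = frk I p q.
Proof.
move=> cI [diag rows].
have above k : forall p q, p + q + k = n -> rk v p q = frk I p q.
  elim: k => [|k IH] p q pqk.
    have -> : q = n - p by lia.
    by rewrite -/(rho p) -diag /frk; lia.
  have pn : p < n by lia.
  have := IH p.+1 q; have := rkSl v (Ordinal pn) q.
  have := alphaS I (Ordinal pn); rewrite /frk /= => -> ->.
  (* For a dot on or above the antidiagonal, avoidance makes the rank at [(p, v p)] zero, hence also
     at [(p, q)] if [q <= v p]. *)
  have := rows (Ordinal pn); have /avoids_rk/(_ (Ordinal pn)) /= := av.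
  rewrite -val_eqE /=; have := @rk_mono n v p q p (v (Ordinal pn)) (leqnn p).
  case: (v (Ordinal pn)) => x xn /=.
  case: (_ \in I) => /=; lia.
have below k : forall p q, p <= n -> q <= n -> p + q = n + k -> rk v p q = frk I p q.
  elim: k => [|k IH] p q pn qn pqk; first by apply: (above 0); lia.
  case: p => [|p] in pn pqk *; first by lia.
  have := IH p q (ltnW pn) qn; have := rkSl v (Ordinal pn) q.
  have := alphaS I (Ordinal pn); rewrite /frk /= => -> ->.
  have := rows (Ordinal pn); have /avoids_rk/(_ (Ordinal pn)) /= := av.
  rewrite -val_eqE /=.
  (* Dually, a dot on or below the antidiagonal gives its south-east corner the least rank allowed
     by [rk_ge]; [rk_stepr] carries this to larger [q]. *)
  have := rkSl v (Ordinal pn) (v (Ordinal pn)).+1.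
  have := rkSr v p (v (Ordinal pn)); rewrite permK /= !ltnn ltnSn => -> /=.
  have := @rk_stepr n v p.+1 (v (Ordinal pn)).+1 q; rewrite qn andbT.
  have := rk_ge v pn qn.
  have := rkSl v (Ordinal pn) q; rewrite /= => ->.
  case: (v (Ordinal pn)) => x xn /=.
  case: (_ \in I) => /=; lia.
move=> p q pn qn; have [pq|pq] := leqP (p + q) n.
  by apply: (above (n - (p + q))); lia.
by apply: (below (p + q - n)); lia.
Qed.

End Diagonal.

End Fibre.

(** * Counting a fibre *)

(* A step (d, e) lowers the height by d and raises it by e.  Free steps are
   marked None; a forced step Some u has to be taken at height 0, which it
   leaves unchanged. *)
Fixpoint walk (s : seq (option (bool * bool))) (t : seq (bool * bool)) (m : nat) :=
  match s, t with
  | [::], [::] => m == 0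
  | Some u :: s', x :: t' => [&& m == 0, x == u & walk s' t' 0]
  | None :: s', x :: t' => (x.1 <= m + x.2) && walk s' t' (m + x.2 - x.1)
  | _, _ => false
  end.

(** The factor 2 stands for the level steps [(false, false)] and [(true, true)], both allowed at
    height 0. *)
Fixpoint walks (b : seq bool) (m : nat) : nat :=
  match b with
  | [::] => m == 0
  | false :: b' => (m == 0) * walks b' 0
  | true :: b' =>
    walks b' m.+1 + 2 * walks b' m + (if m is k.+1 then walks b' k else 0)
  end.

Lemma sum_tupleS (T : finType) k (P : pred (seq T)) :
  \sum_(t : k.+1.-tuple T | P t) 1 =
  \sum_(x : T) \sum_(t : k.-tuple T | P (x :: t)) 1.
Proof.
rewrite pair_big_dep /=.
rewrite (reindex (fun xt : T * k.-tuple T => [tuple of xt.1 :: xt.2])) //=.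
exists (fun t : k.+1.-tuple T => (thead t, [tuple of behead t])) => [[x t] _|t _] /=.
  by congr pair; apply: val_inj.
by rewrite [RHS]tuple_eta.
Qed.

Lemma count_walks s m :
  \sum_(t : (size s).-tuple (bool * bool) | walk s t m) 1 = walks (map (fun u => ~~ isSome u) s) m.
Proof.
elim: s m => [|u s IH] m.
  case: m => [|m] /=; last by rewrite big_pred0 // => t; rewrite tuple0.
  rewrite (eq_bigl xpredT) => [|t]; last by rewrite tuple0.
  by rewrite sum1_card card_tuple.
rewrite /= (sum_tupleS (size s) (fun t => walk (u :: s) t m)).
case: u => [[d e]|] /=.
  case: m => [|m] /=; last by rewrite big1 // => x _; rewrite big_pred0.
  rewrite (bigD1 (d, e)) //= eqxx IH mul1n big1 ?addn0 // => x /negPf ->.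
  by rewrite big_pred0.
rewrite -(pair_bigA _ (fun a b : bool => \sum_(t : (size s).-tuple _ |
  (a <= m + b) && walk s t (m + b - a)) 1)) /= !big_bool /=.
rewrite addn1 subSS addn0 !subn0 /= !IH.
case: m => [|m] /=; first by rewrite big_pred0 //; lia.
by rewrite subn1 /= IH; lia.
Qed.

(** * Column sets as walks *)

Section Bits.
Variable n : nat.
Implicit Types (v w : 'S_n) (I : {set 'I_(n + n)}).

(** The step from [(p, n - p)] to [(p.+1, n - p.+1)] adds row [p] to [alpha] and removes column
    [rev_ord p] from [beta], whence the reversal. *)
Definition bits I (p : 'I_n) : bool * bool :=
  (rshift n p \notin I, lshift n (rev_ord p) \in I).

Definition bits_tuple I : n.-tuple (bool * bool) := mktuple (bits I).

Lemma bits_tuple_bij : bijective bits_tuple.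
Proof.
exists (fun t : n.-tuple (bool * bool) => [set x | match split x with
  | inl j => (tnth t (rev_ord j)).2 | inr i => ~~ (tnth t i).1 end]) => [I|t].
  apply/setP => x; rewrite inE; case: splitP => j xj; rewrite tnth_mktuple /=.
    by rewrite rev_ordK; congr (_ \in I); apply: val_inj.
  by rewrite negbK; congr (_ \in I); apply: val_inj.
apply: eq_from_tnth => i; rewrite tnth_mktuple /bits !inE.
rewrite (unsplitK (inl _)) (unsplitK (inr _)) rev_ordK negbK.
by rewrite -surjective_pairing.
Qed.

Section Avoider.
Variables (v : 'S_n) (av : avoids123 v).

(** A forced step is the one [rho v] itself makes, which keeps the height at 0. *)
Definition spec (p : 'I_n) : option (bool * bool) :=
  if v p == rev_ord p then None else Some (p + v p < n, colD v p).

Let drop_enum p (pn : p < n) (T : Type) (f : 'I_n -> T) :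
  map f (drop p (enum 'I_n)) =
  f (Ordinal pn) :: map f (drop p.+1 (enum 'I_n)).
Proof.
rewrite (drop_nth (Ordinal pn)) ?size_enum_ord //=; congr (f _ :: _).
by apply: val_inj; rewrite /= nth_enum_ord.
Qed.

(* The height of the walk at p is m(p) = r_v(p, n - p) - s(p). *)
Lemma walk_invariant I p m k : p + k = n ->
  m + alpha I p + beta I (n - p) = rho v p + beta I n ->
  walk (map spec (drop p (enum 'I_n))) (map (bits I) (drop p (enum 'I_n))) m ->
  [/\ alpha I n = beta I n,
      forall i, p <= i <= n -> alpha I i + beta I (n - i) - beta I n = rho v i &
      forall i : 'I_n, p <= i -> v i != rev_ord i ->
        (rshift n i \notin I) = (i + v i < n)].
Proof.
elim: k p m => [|k IH] p m.
  rewrite addn0 => -> inv; rewrite drop_oversize ?size_enum_ord //= => /eqP m0.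
  (* Final height 0 is the condition [alpha I n = beta I n], that is [#|I| = n]. *)
  move: inv; rewrite m0 /rho subnn beta0 rk0r => inv.
  split; [lia | move=> i ni|by move=> i; rewrite leqNgt ltn_ord].
  by rewrite (_ : i = n) ?subnn ?beta0 ?rk0r; lia.
move=> pk inv; have pn : p < n by lia.
rewrite !(drop_enum pn) /= {1}/spec.
have := alpha_betaS I (Ordinal pn); have := rhoS v (Ordinal pn).
set P := Ordinal pn; rewrite /= => rhoE abE.
have pk' : p.+1 + k = n by lia.
have diagP : alpha I p + beta I (n - p) - beta I n = rho v p ->
    [/\ alpha I n = beta I n,
      forall i, p.+1 <= i <= n -> alpha I i + beta I (n - i) - beta I n = rho v i &
      forall i : 'I_n, p.+1 <= i -> v i != rev_ord i ->
        (rshift n i \notin I) = (i + v i < n)] ->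
    (v P != rev_ord P -> (rshift n P \notin I) = (P + v P < n)) ->
    [/\ alpha I n = beta I n,
      forall i, p <= i <= n -> alpha I i + beta I (n - i) - beta I n = rho v i &
      forall i : 'I_n, p <= i -> v i != rev_ord i ->
        (rshift n i \notin I) = (i + v i < n)].
  move=> dp [ab diag rows] rowP; split=> // i.
    by have [->|ip] := eqVneq i p; [|move=> ?; apply: diag; lia].
  have [-> _|iP pi] := eqVneq i P; first exact: rowP.
  by apply: rows; move: iP; rewrite -val_eqE /=; lia.
case: (eqVneq (v P) (rev_ord P)) => [vP|vP].
  have /= [r0 r1] := rho_antifixed av vP => /andP[m_ge walkP].
  apply: diagP; [lia| |by rewrite vP eqxx].
  apply: IH walkP => //; move: abE m_ge.
  by rewrite /bits /=; case: (_ \notin I); case: (_ \in I) => /=; lia.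
case/and3P => /eqP m0 /eqP [rowE colE] walkP.
apply: diagP; [lia| |by rewrite rowE].
apply: IH walkP => //; move: abE rhoE vP; rewrite rowE colE -val_eqE /=.
by case: (colD v P); case: (v P) => x xn /=; lia.
Qed.

(** At a forced step [rho] is positive at one end; there the subtraction in [fibre_cond] is exact,
    and this forces height 0 and the column bit. *)
Lemma fibre_cond_walk I p m k : p + k = n ->
  m + alpha I p + beta I (n - p) = rho v p + beta I n ->
  alpha I n = beta I n -> fibre_cond v I ->
  walk (map spec (drop p (enum 'I_n))) (map (bits I) (drop p (enum 'I_n))) m.
Proof.
move=> pk inv ab [diag rows]; elim: k p m pk inv => [|k IH] p m.
  rewrite addn0 => -> inv; rewrite drop_oversize ?size_enum_ord //=.
  by move: inv; rewrite /rho subnn beta0 rk0r; lia.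
move=> pk inv; have pn : p < n by lia.
rewrite !(drop_enum pn) /= {1}/spec.
have := alpha_betaS I (Ordinal pn); have := rhoS v (Ordinal pn).
have := diag p (ltnW pn); have := diag p.+1 pn; have := rows (Ordinal pn).
set P := Ordinal pn; rewrite /= => rowE dp1 dp rhoE abE.
have pk' : p.+1 + k = n by lia.
case: (eqVneq (v P) (rev_ord P)) => [vP|vP].
  have /= [r0 r1] := rho_antifixed av vP.
  have m_ge : (rshift n P \notin I) <= m + (lshift n (rev_ord P) \in I).
    by move: abE; case: (_ \notin I); case: (_ \in I) => /=; lia.
  apply/andP; split => //; apply: IH => //; move: abE m_ge.
  by rewrite /bits /=; case: (_ \notin I); case: (_ \in I) => /=; lia.
have := rho_nonantifixed vP; have := rowE vP; rewrite /= => {}rowE r_gt0.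
have vPE : (v P < n - p.+1) = (p + v P < n).
  by move: vP; rewrite -val_eqE /=; case: (v P) => x xn /=; lia.
move: abE rhoE; rewrite rowE vPE => abE rhoE.
have m0 : m = 0.
  by move: abE rhoE; case: (_ < n); case: (_ \in I); case: colD => /=; lia.
have colE : (lshift n (rev_ord P) \in I) = colD v P.
  by move: abE rhoE; case: (_ < n); case: (_ \in I); case: colD => /=; lia.
rewrite m0 /bits rowE colE !eqxx /=; apply: IH => //.
by move: abE rhoE; rewrite colE; case: (_ < n); case: colD => /=; lia.
Qed.

Lemma walk_frk I :
  walk (map spec (enum 'I_n)) (map (bits I) (enum 'I_n)) 0 <->
  (#|I| = n /\ forall p q, p <= n -> q <= n -> rk v p q = frk I p q).
Proof.
have inv0 : 0 + alpha I 0 + beta I (n - 0) = rho v 0 + beta I n.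
  by rewrite alpha0 subn0 /rho rk0l.
have ab := card_alpha_beta I; split=> [walkI|[cI E]].
  have := @walk_invariant I 0 0 n (add0n n) inv0.
  rewrite !drop0 => /(_ walkI) [aE diag rows].
  have cI : #|I| = n by lia.
  by split=> //; apply: fibre_cond_frk => //; split=> [i|i]; [apply: diag|apply: rows].
have := @fibre_cond_walk I 0 0 n (add0n n) inv0; rewrite !drop0; apply; first lia.
exact: frk_fibre_cond.
Qed.

Lemma card_fibre :
  \sum_(I : {set 'I_(n + n)} |
     (#|I| == n) && [forall p : 'I_n.+1, forall q : 'I_n.+1, rk v p q == frk I p q]) 1
  = walks [seq i \in antifixed v | i <- enum 'I_n] 0.
Proof.
pose s := map spec (enum 'I_n).
have -> : [seq i \in antifixed v | i <- enum 'I_n] = map (fun u => ~~ isSome u) s.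
  rewrite /s -map_comp; apply: eq_map => i /=; rewrite inE /spec.
  by case: ifP.
have sz : size s = n by rewrite size_map size_enum_ord.
rewrite -count_walks sz (reindex bits_tuple) /=; last first.
  exact: onW_bij bits_tuple_bij.
apply: eq_bigl => I; apply/andP/idP.
  case=> /eqP cI /forallP E; rewrite -/s; apply/walk_frk; split=> // p q pn qn.
  have /forallP/(_ (inord q))/eqP := E (inord p).
  by rewrite !inordK.
move/walk_frk => [-> E]; split=> //; apply/forallP => p; apply/forallP => q.
by rewrite E // -ltnS.
Qed.

End Avoider.
End Bits.

(** * Runs of antifixed points *)

(** A forced step is taken at height 0 only, so it cuts the walk in two. *)
Lemma walks_cat_false l b m :
  walks (nseq l true ++ false :: b) m = walks (nseq l true) m * walks b 0.
Proof.
by elim: l m => [|l IH] m //=; rewrite !IH; case: m => [|m]; rewrite ?IH; lia.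
Qed.

(* By the reflection principle; the binomials vanish for m > l. *)
Lemma walks_binomial l m :
  walks (nseq l true) m + 'C(l.*2.+1, l + m + 2) = 'C(l.*2.+1, l + m + 1).
Proof.
elim: l m => [|l IH] m; first by case: m => [|m] //=; rewrite !bin_small; lia.
have binSS k : 'C(l.+1.*2.+1, k.+2) =
    'C(l.*2.+1, k.+2) + 2 * 'C(l.*2.+1, k.+1) + 'C(l.*2.+1, k).
  by rewrite doubleS !binS; lia.
have -> : l.+1 + m + 2 = (l + m + 1).+2 by lia.
have -> : l.+1 + m + 1 = (l + m).+2 by lia.
rewrite !binSS /=.
have := IH m.+1; have := IH m; rewrite !(addn1, addn2, addnS).
case: m => [|m]; last by have := IH m; rewrite !(addn1, addn2, addnS, addSn); lia.
(* At height 0 the missing down step matches the formula at [m = -1], which is 0 by this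
   symmetry. *)
rewrite !addn0; have : 'C(l.*2.+1, l) = 'C(l.*2.+1, l.+1).
  by rewrite -bin_sub; [congr binomial|]; lia.
lia.
Qed.

Lemma walks_catalan l : walks (nseq l true) 0 = catalan l.+1.
Proof.
have := walks_binomial l 0; rewrite addn0 addn1 addn2 => W.
(* This evaluates [l.+2] times the subtracted binomial as [l] times the other, so the difference
   times [l.+2] is twice the latter. *)
have := mul_bin_left l.*2.+1 l.+1; have -> : l.*2.+1 - l.+1 = l by lia.
move=> binL; rewrite /catalan.
have -> : 2 * l.+1 = l.*2.+2 by lia.
rewrite binS; have -> : 'C(l.*2.+1, l) = 'C(l.*2.+1, l.+1).
  by rewrite -bin_sub; [congr binomial|]; lia.
have -> : 'C(l.*2.+1, l.+1) + 'C(l.*2.+1, l.+1) = walks (nseq l true) 0 * l.+2.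
  nia.
by rewrite mulnK.
Qed.

Lemma split_run (b : seq bool) :
  exists l, b = nseq l true \/ exists b', b = nseq l true ++ false :: b'.
Proof.
elim: b => [|[] b [l IH]]; first by exists 0; left.
  by exists l.+1; case: IH => [->|[b' ->]]; [left|right; exists b'].
by exists 0; right; exists b.
Qed.

Section Runs.
Variables (n : nat) (F : {set 'I_n}).

Definition run : pred {set 'I_n} :=
  maxset (fun B : {set 'I_n} => is_interval B && (B \subset F)).

Lemma runP A : reflect
  (exists a b : 'I_n, [/\ a <= b, A = [set i : 'I_n | a <= i <= b], A \subset F &
     forall B : {set 'I_n}, is_interval B -> B \subset F -> A \subset B -> B = A])
  (run A).
Proof.
apply: (iffP maxsetP) => [[/andP[/existsP[a /existsP[b]]]]|].
  case/andP=> ab /eqP AE AF max; exists a, b; split=> // B iB BF.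
  by apply: max; rewrite iB.
case=> a [b [ab AE AF max]]; split=> [|B /andP[iB BF]]; last exact: max.
rewrite AF andbT; apply/existsP; exists a; apply/existsP; exists b.
by rewrite ab AE eqxx.
Qed.

Let mem_list p : seq bool := [seq i \in F | i <- drop p (enum 'I_n)].

Let nth_list p k (h : p + k < n) d : nth d (mem_list p) k = (Ordinal h \in F).
Proof.
rewrite (nth_map (Ordinal h)) ?size_drop ?size_enum_ord; last lia.
congr (_ \in F); apply: val_inj; rewrite nth_drop /=.
by rewrite nth_enum_ord.
Qed.

Let size_list p : size (mem_list p) = n - p.
Proof. by rewrite size_map size_drop size_enum_ord. Qed.

(** Scan from left to right: the leading block of [l] members of [F] is a run if [l > 0], and the
    scan restarts after the non-member that ends it. The last hypothesis keeps runs from extending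
    to the left of [p]. *)
Lemma prod_runs_from k p : p <= n -> n - p < k ->
  (forall i : 'I_n, i.+1 = p -> i \notin F) ->
  \prod_(A | run A && [forall i in A, p <= i]) catalan #|A|.+1
  = walks (mem_list p) 0.
Proof.
elim: k p => // k IH p pn pk start.
have [l lP] := split_run (mem_list p).
have inF (i : 'I_n) : p <= i < p + l -> i \in F.
  case/andP=> pi il; have h : p + (i - p) < n by have := ltn_ord i; lia.
  have -> : i = Ordinal h by apply: val_inj => /=; lia.
  rewrite -(nth_list h true); case: lP => [->|[b' ->]].
    by rewrite nth_nseq; case: ifP.
  by rewrite nth_cat size_nseq nth_nseq (_ : i - p < l) //; lia.
have pln : p + l <= n.
  by have := size_list p; case: lP => [|[b']] ->; rewrite ?size_cat size_nseq /=; lia.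
have stop (i : 'I_n) : p + l = i -> i \notin F.
  move=> ipl; have h : p + l < n by rewrite ipl ltn_ord.
  have -> : i = Ordinal h by apply: val_inj.
  rewrite -(nth_list h true); case: lP => [lE|[b' ->]].
    by have := size_list p; rewrite lE size_nseq; lia.
  by rewrite nth_cat size_nseq ltnn subnn.
have walksE : walks (mem_list p) 0 =
    catalan l.+1 * \prod_(A | run A && [forall i in A, (p + l).+1 <= i]) catalan #|A|.+1.
  have [pl|pl] := eqVneq (p + l) n.
    rewrite big_pred0 => [|A].
      case: lP => [->|[b' bE]]; first by rewrite walks_catalan muln1.
      by have := size_list p; rewrite bE size_cat size_nseq /=; lia.
    apply/andP=> -[/runP[a [b [ab -> _ _]]] /forallP/(_ a)].
    by rewrite inE leqnn ab /= pl; have := ltn_ord a; lia.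
  have h : p + l < n by lia.
  rewrite IH //; [|lia|by move=> i [/esym/stop]].
  case: lP => [lE|[b' bE]]; first by have := size_list p; rewrite lE size_nseq; lia.
  rewrite bE walks_cat_false walks_catalan; congr (_ * walks _ 0).
  have -> : mem_list (p + l).+1 = drop l.+1 (mem_list p).
    by rewrite /mem_list -map_drop drop_drop; congr (map _ (drop _ _)); lia.
  by rewrite bE drop_cat size_nseq ltnNge leqnSn /= subSnn /= drop0.
have beyond A : run A -> [forall i in A, p <= i] ->
    [forall i in A, (p + l).+1 <= i] \/ A = [set i : 'I_n | p <= i < p + l] /\ 0 < l.
  case/runP=> a [b [ab AE AF max]] /forallP Ap.
  have Aa : a \in A by rewrite AE inE leqnn.
  have pa : p <= a by have := Ap a; rewrite Aa.
  have notin (i : 'I_n) : p + l = i -> i \notin A.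
    by move=> /stop; apply: contraNN; apply: (subsetP AF).
  have [apl|apl] := ltnP (p + l) a.
    by left; apply/forallP => i; apply/implyP; rewrite AE inE; lia.
  have alt : a < p + l.
    by rewrite ltn_neqAle apl andbT; apply/eqP => /esym/notin; rewrite Aa.
  have blt : b < p + l.
    rewrite ltnNge; apply/negP => bpl.
    have h : p + l < n by have := ltn_ord b; lia.
    by have := notin (Ordinal h) erefl; rewrite AE inE /=; lia.
  right; split; last by lia.
  apply/esym/max.
  - have h0 : p < n by lia.
    have h1 : (p + l).-1 < n by lia.
    apply/existsP; exists (Ordinal h0); apply/existsP; exists (Ordinal h1) => /=.
    apply/andP; split; first by lia.
    by apply/eqP/setP => i; rewrite !inE; lia.
  - by apply/subsetP => i; rewrite inE => /inF.
  - by apply/subsetP => i; rewrite AE !inE; lia.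
have geS (A : {set 'I_n}) : [forall i in A, (p + l).+1 <= i] -> [forall i in A, p <= i].
  move=> /forallP H; apply/forallP => i; apply/implyP => iA.
  by have := H i; rewrite iA /=; lia.
(* An empty block is no run, but its factor [catalan 1] is 1. *)
rewrite walksE; have [l0|l_gt0] := posnP l.
  rewrite [in X in X * _]l0 mul1n; apply: eq_bigl => A.
  apply/andP/andP => [[rA Ap]|[rA Ap]]; split => //; last exact: geS.
  by have [|[_]] := beyond A rA Ap; rewrite // l0.
pose A0 := [set i : 'I_n | p <= i < p + l].
have cA0 : #|A0| = l.
  apply: (@addIn p); rewrite addnC -[in LHS](sum_ltn pn) addnC -[RHS]addnC.
  rewrite -[in RHS](sum_ltn pln) -sum1_card big_mkcond -big_split /=.
  by apply: eq_bigr => i _; rewrite inE; case: ifP; lia.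
have p_lt : p < n by lia.
have rA0 : run A0.
  have h1 : (p + l).-1 < n by lia.
  apply/runP; exists (Ordinal p_lt), (Ordinal h1); split => /=; [lia| | |].
  - by apply/setP => i; rewrite !inE /=; lia.
  - by apply/subsetP => i; rewrite inE => /inF.
  move=> B /existsP[a /existsP[b /andP[ab /eqP ->]]] BF A0B.
  have := subsetP A0B (Ordinal p_lt); have := subsetP A0B (Ordinal h1).
  rewrite !inE /= => /(_ _)/andP[|_ pb]; first by lia.
  move=> /(_ _)/andP[|ap _]; first by lia.
  have pa : p <= a.
    rewrite leqNgt; apply/negP => lt_ap.
    have h : p.-1 < n by lia.
    have := start (Ordinal h) (ltn_predK lt_ap); apply/negP; rewrite negbK.
    by apply: (subsetP BF); rewrite inE /=; lia.
  have bp : b < p + l.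
    rewrite ltnNge; apply/negP => le_b.
    have h : p + l < n by have := ltn_ord b; lia.
    have := stop (Ordinal h) erefl; apply/negP; rewrite negbK.
    by apply: (subsetP BF); rewrite inE /=; lia.
  by apply/setP => i; rewrite !inE; lia.
rewrite (bigD1 A0) /=; last first.
  by rewrite rA0; apply/forallP => i; apply/implyP; rewrite inE => /andP[].
rewrite cA0; congr (_ * _); apply: eq_bigl => A.
apply/andP/andP => [[/andP[rA Ap] AA0]|[rA Ap]].
  by split => //; have [//|[AE _]] := beyond A rA Ap; rewrite AE eqxx in AA0.
rewrite rA geS //; split=> //; apply/eqP => AE.
have /forallP/(_ (Ordinal p_lt)) := Ap; rewrite AE inE /=; lia.
Qed.

Lemma prod_runs : \prod_(A | run A) catalan #|A|.+1 = walks [seq i \in F | i <- enum 'I_n] 0.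
Proof.
rewrite -[enum _]drop0 -(@prod_runs_from n.+1 0) //; last by rewrite ltnS leq_subr.
by apply: eq_bigl => A; rewrite (introT forallP) ?andbT // => i; apply/implyP.
Qed.

End Runs.

(** * Bases grouped by their permutation *)

Theorem theorem1p1 (n : nat) (hn : (1 <= n)%N) (w : 'S_n)
    (k K : fieldType) (iota : {rmorphism k -> K})
    (M : 'M[K]_(n, n + n)) (hM : generic_mx iota w M) :
  #|bases M| = (\sum_(v : 'S_n | bruhat_le w v && avoids123 v) g v)%N.
Proof.
pose fits (v : 'S_n) (I : {set 'I_(n + n)}) :=
  [forall p : 'I_n.+1, forall q : 'I_n.+1, rk v p q == frk I p q].
have fitsP v I : reflect (forall p q, p <= n -> q <= n -> rk v p q = frk I p q) (fits v I).
  apply: (iffP forallP) => [E p q pn qn|E p].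
    by have /forallP/(_ (inord q))/eqP := E (inord p); rewrite !inordK.
  by apply/forallP => q; apply/eqP/E; rewrite -ltnS.
have basesE I : (I \in bases M) = (#|I| == n) && [exists v, fits v I && bruhat_le w v].
  rewrite inE; case: eqP => //= cI; apply/idP/existsP.
    move=> /(transversal_minor hM cI)/transversal_rk le_w.
    have [v vE] := frk_perm cI; exists v; apply/andP; split; first exact/fitsP.
    (* Ranks are constant beyond [n], so the arguments can be clipped to the range where [frk] is
       matched. *)
    apply/bruhat_le_rk => p q; rewrite (rk_min v) (rk_min w) vE ?geq_minr //.
    by apply: le_w; rewrite geq_minr.
  case=> v /andP[/fitsP vE /bruhat_le_rk le_w].
  apply: (minor_transversal hM cI); apply/transversal_rk => p q pn qn.
  by rewrite -vE.
have fits_inj v v' I : fits v I -> fits v' I -> v = v'.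
  by move=> /fitsP E /fitsP E'; apply: rk_inj => p q pn qn; rewrite E ?E'.
(* With [g v] replaced by the size of its fibre, exchanging the sums counts each basis once, at the
   only [v] it fits. *)
rewrite -sum1_card (eq_bigr (fun v : 'S_n =>
    \sum_(I : {set 'I_(n + n)} | (#|I| == n) && fits v I) 1)).
  rewrite (exchange_big_dep (fun I => I \in bases M)) /=.
    apply: eq_bigr => I; rewrite basesE => /andP[cI /existsP[v /andP[vI wv]]].
    rewrite (big_pred1 v) // => v' /=; rewrite cI /=.
    apply/andP/eqP => [[_ v'I]|->]; first exact: fits_inj v'I vI.
    by rewrite wv (frk_avoids (fitsP _ _ vI)).
  move=> v I /andP[wv _] /andP[cI vI]; rewrite basesE cI /=.
  by apply/existsP; exists v; rewrite vI.
move=> v /andP[_ av]; rewrite (card_fibre av) -prod_runs.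
by apply: eq_bigl.
Qed.
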